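(* For every finite alphabet $\Sigma$ and every context-free language $L \subseteq \Sigma^+$ there exist a finite alphabet $\Omega$, a homomorphism $h \colon \Sigma \to \Omega^+$ (extended to strings by $h(a_1 \ldots a_n)=h(a_1)\ldots h(a_n)$), and a categorial grammar $G=(\Omega, \mathrm{BC}, \triangleright, S)$ with unique category assignment, such that for every string $w \in \Sigma^+$, $w$ is in $L$ if and only if $h(w)$ is in $L(G)$.
   Context: All languages are assumed to be without the empty string: $\Sigma^+$ is the set of non-empty strings over $\Sigma$, and a language over $\Sigma$ is a subset of $\Sigma^+$. Let $\mathrm{BC}$ be a finite set of primitive categories. The set of categories is defined inductively: every primitive category is a category; if $A$ and $B$ are categories, then so are $(B \backslash A)$ and $(A / B)$. Strings of categories are written with semicolons between individual categories. A categorial grammar is a quadruple $(\Sigma, \mathrm{BC}, \triangleright, S)$, where $\Sigma$ is a finite alphabet, $\mathrm{BC}$ is a finite set of primitive categories, $\triangleright$ is a finite relation of category assignments of the form $a \triangleright A$ with $a \in \Sigma$ and $A$ a category, and $S$ is a category (not necessarily primitive) designated as the target category. A string of categories $\alpha$ is reducible in one step to a string of categories $\beta$ if $\alpha=\eta; A/B; B; \theta$ or $\alpha=\eta; B; B \backslash A; \theta$, while $\beta=\eta; A; \theta$, for some categories $A, B$ and some (possibly empty) strings of categories $\eta,\theta$. A string $\alpha$ is reducible to $\beta$ if it can be transformed to $\beta$ by zero or more such steps. The language defined by $G=(\Sigma, \mathrm{BC}, \triangleright, S)$ is the set $L(G)$ of all strings $a_1 \ldots a_n$ ($n \geqslant 1$,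 $a_i \in \Sigma$) for which there exists a string of categories $A_1; \ldots; A_n$ with $a_i \triangleright A_i$ for all $i$ that is reducible to $S$. A categorial grammar is with unique category assignment if for every symbol $a$ of its alphabet there is a unique category $A$ with $a \triangleright A$. *)

(* Defs.v *)
From HB Require Import structures.
From mathcomp Require Import all_boot.
From Stdlib Require Export Relation_Operators.

Set Implicit Arguments.
Unset Strict Implicit.
Unset Printing Implicit Defensive.

(** The empty string is not excluded here: that a language is a subset of Sigma^+
    is a separate condition. *)
Definition language (Sigma : Type) := seq Sigma -> Prop.

Record cfg (Sigma : finType) := Cfg {
  nonterminal : finType;
  start : nonterminal;
  rules : seq (nonterminal * seq (nonterminal + Sigma))
}.

Inductive cfg_step (Sigma : finType) (G : cfg Sigma) :
    seq (nonterminal G + Sigma) -> seq (nonterminal G + Sigma) -> Prop :=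
  CfgStep eta theta X rhs of (X, rhs) \in rules G :
    cfg_step (eta ++ inl X :: theta) (eta ++ rhs ++ theta).

Definition cfg_lang (Sigma : finType) (G : cfg Sigma) : language Sigma :=
  fun w => clos_refl_trans _ (@cfg_step Sigma G)
             [:: inl (start G)] [seq inr a | a <- w].

Definition context_free (Sigma : finType) (L : language Sigma) : Prop :=
  exists G : cfg Sigma, forall w, L w <-> cfg_lang G w.

(** The arguments of both connectives are in their written order:
    [Under B A] is B\A, and [Over A B] is A/B. *)
Inductive category (BC : Type) : Type :=
  | Prim of BC
  | Under of category BC & category BC
  | Over of category BC & category BC.

Section CategoryEncoding.
Variable BC : Type.

Fixpoint category_encode (A : category BC) : GenTree.tree BC :=
  match A with
  | Prim p => GenTree.Leaf p
  | Under B C => GenTree.Node 0 [:: category_encode B; category_encode C]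
  | Over B C => GenTree.Node 1 [:: category_encode B; category_encode C]
  end.

Fixpoint category_decode (t : GenTree.tree BC) : option (category BC) :=
  match t with
  | GenTree.Leaf p => Some (Prim p)
  | GenTree.Node n [:: t1; t2] =>
      match category_decode t1, category_decode t2 with
      | Some B, Some C => Some (if n is 0 then Under B C else Over B C)
      | _, _ => None
      end
  | _ => None
  end.

Lemma category_encodeK : pcancel category_encode category_decode.
Proof. by elim=> //= B -> C ->. Qed.
End CategoryEncoding.

HB.instance Definition _ (BC : countType) :=
  Countable.copy (category BC) (pcan_type (@category_encodeK BC)).

Record cat_grammar (Omega : finType) := CatGrammar {
  prim_cat : finType;
  assignment : seq (Omega * category prim_cat);
  target : category prim_cat
}.

Definition assigned (Omega : finType) (G : cat_grammar Omega)
    (a : Omega) (A : category (prim_cat G)) : bool :=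
  (a, A) \in assignment G.

Inductive reduce_step (BC : Type) :
    seq (category BC) -> seq (category BC) -> Prop :=
  | ReduceOver eta theta A B :
      reduce_step (eta ++ [:: Over A B; B] ++ theta) (eta ++ A :: theta)
  | ReduceUnder eta theta A B :
      reduce_step (eta ++ [:: B; Under B A] ++ theta) (eta ++ A :: theta).

Definition reducible (BC : Type) : seq (category BC) -> seq (category BC) -> Prop :=
  clos_refl_trans _ (@reduce_step BC).

Definition cat_lang (Omega : finType) (G : cat_grammar Omega) : language Omega :=
  fun w => w != [::] /\
    exists2 alpha : seq (category (prim_cat G)),
      all2 (@assigned Omega G) w alpha & reducible alpha [:: target G].

Definition unique_assignment (Omega : finType) (G : cat_grammar Omega) : Prop :=
  forall a : Omega, exists! A : category (prim_cat G), assigned a A.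

Definition hom_ext (Sigma Omega : Type) (h : Sigma -> seq Omega)
    (w : seq Sigma) : seq Omega := flatten [seq h a | a <- w].

(* Main.v *)
From HB Require Import structures.
Require Import Defs.
From mathcomp Require Import all_boot.
From mathcomp Require Import boolp.

Set Implicit Arguments.
Unset Strict Implicit.
Unset Printing Implicit Defensive.

(** The context-free grammar is brought to a form in which every rule is
    [X -> Y s Z], with a symbol [s] between two nonterminals, apart from nonterminals
    generating a fixed leaf symbol; a word [a1 .. an] becomes [. l a1 r . l a2 r ..]
    with leaf symbols [l], [r] and a concatenation symbol [.].  The code of [s]
    consists of gadgets for all rules with this [s], followed by the category [cW].
    A gadget reduces either to [cB cB], where [cB = cW/cW] is absorbed by a [cW] to
    the right of it, or, absorbing the [cB]s to the left of it, to a functor that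
    turns the closing [cW] into the category [(Y\X)/Z] of its rule.  In the former
    case that category is applied inside the gadget to dummy arguments, which are
    absorbed in the latter case.

    Conversely, a constituent of a reduction occupies an interval of the encoded
    word, and the combinations of its category with the first and the last symbol of
    the interval are confined to the list [item]; in particular, a constituent [q]
    between two leaf symbols encodes a word generated by [q]. *)

(** * Reductions of strings of categories *)

Section Reductions.
Variable BC : Type.
Implicit Types (alpha beta gamma eta theta : seq (category BC)) (A B : category BC).

Lemma reducible_refl alpha : reducible alpha alpha.
Proof. exact: rt_refl. Qed.

Lemma reducible_trans beta alpha gamma :
  reducible alpha beta -> reducible beta gamma -> reducible alpha gamma.
Proof. exact: rt_trans. Qed.

Lemma reducible_ctx eta theta alpha beta :
  reducible alpha beta -> reducible (eta ++ alpha ++ theta) (eta ++ beta ++ theta).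
Proof.
elim=> {alpha beta} [alpha beta|alpha|alpha beta gamma _ IH1 _ IH2]; last first.
- exact: reducible_trans IH1 IH2.
- exact: reducible_refl.
case=> eta' theta' A B; rewrite -!catA !(catA eta); apply: rt_step.
- exact: (ReduceOver (eta ++ eta') (theta' ++ theta)).
- exact: (ReduceUnder (eta ++ eta') (theta' ++ theta)).
Qed.

Lemma reducible_cat alpha1 alpha2 beta1 beta2 :
  reducible alpha1 beta1 -> reducible alpha2 beta2 ->
  reducible (alpha1 ++ alpha2) (beta1 ++ beta2).
Proof.
move=> red1 red2; apply: (@reducible_trans (beta1 ++ alpha2)).
- exact: (@reducible_ctx [::] alpha2).
- by have := @reducible_ctx beta1 [::] _ _ red2; rewrite !cats0.
Qed.

Lemma reducible_over eta theta A B gamma :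
  reducible (eta ++ A :: theta) gamma ->
  reducible (eta ++ Over A B :: B :: theta) gamma.
Proof. by apply: reducible_trans; apply: rt_step; exact: ReduceOver. Qed.

Lemma reducible_under eta theta A B gamma :
  reducible (eta ++ A :: theta) gamma ->
  reducible (eta ++ B :: Under B A :: theta) gamma.
Proof. by apply: reducible_trans; apply: rt_step; exact: ReduceUnder. Qed.

Lemma reducible_absorb n A :
  reducible (nseq n (Over A A) ++ [:: A]) [:: A].
Proof.
elim: n => [|n IHn]; first exact: reducible_refl.
apply: (reducible_trans (reducible_cat (reducible_refl [:: Over A A]) IHn)).
exact: (@reducible_over [::]) (reducible_refl _).
Qed.

End Reductions.

(** * Derivation trees of reductions *)

Section Parsing.
Variables (T : Type) (BC : Type) (cat_of : T -> category BC).

(** Unlike a sequence of reductions, a tree assigns to each constituent an interval of the input. *)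
Inductive derives : category BC -> seq T -> Prop :=
  | DerivesLex t : derives (cat_of t) [:: t]
  | DerivesOver A B s1 s2 :
      derives (Over A B) s1 -> derives B s2 -> derives A (s1 ++ s2)
  | DerivesUnder A B s1 s2 :
      derives B s1 -> derives (Under B A) s2 -> derives A (s1 ++ s2).

Inductive parses : seq (category BC) -> seq T -> Prop :=
  | ParsesNil : parses [::] [::]
  | ParsesCons A alpha s1 s2 :
      derives A s1 -> parses alpha s2 -> parses (A :: alpha) (s1 ++ s2).

Lemma parses_lex s : parses [seq cat_of t | t <- s] s.
Proof.
elim: s => [|t s IHs] /=; first exact: ParsesNil.
exact: ParsesCons (DerivesLex t) IHs.
Qed.

Lemma parses_consI A alpha s : parses (A :: alpha) s ->
  exists s1 s2, [/\ s = s1 ++ s2, derives A s1 & parses alpha s2].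
Proof. by move=> p; inversion p; subst; do 2!eexists; split; eauto. Qed.

Lemma parses_step alpha beta s : reduce_step alpha beta ->
  parses alpha s -> parses beta s.
Proof.
case=> eta theta A B; elim: eta s => [|C eta IH] s /=.
- move=> /parses_consI[s1 [_ [-> d1 /parses_consI[s2 [s3 [-> d2 p]]]]]].
  by rewrite catA; exact: ParsesCons (DerivesOver d1 d2) p.
- by move=> /parses_consI[s1 [s2 [-> d1 p]]]; exact: ParsesCons d1 (IH _ p).
- move=> /parses_consI[s1 [_ [-> d1 /parses_consI[s2 [s3 [-> d2 p]]]]]].
  by rewrite catA; exact: ParsesCons (DerivesUnder d1 d2) p.
- by move=> /parses_consI[s1 [s2 [-> d1 p]]]; exact: ParsesCons d1 (IH _ p).
Qed.

Lemma reducible_derives s A :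
  reducible [seq cat_of t | t <- s] [:: A] -> derives A s.
Proof.
have parses_red alpha beta : reducible alpha beta -> parses alpha s -> parses beta s.
  elim=> {alpha beta} [alpha beta st|//|alpha beta gamma _ IH1 _ IH2 /IH1/IH2 //].
  exact: parses_step st.
move=> /parses_red/(_ (parses_lex s))/parses_consI[s1 [s2 [-> d p]]].
by inversion p; rewrite cats0.
Qed.

End Parsing.

(** * Unique category assignments as functions *)

Section FunctionalGrammar.
Variables (Omega P : finType) (f : Omega -> category P) (S : category P).

Definition functional_grammar : cat_grammar Omega :=
  CatGrammar [seq (o, f o) | o <- enum Omega] S.

Lemma functional_grammar_assigned o A :
  assigned (G := functional_grammar) o A = (A == f o).
Proof.
apply/mapP/eqP => [[o' _ [-> ->]] //|->].
by exists o; rewrite ?mem_enum.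
Qed.

Lemma functional_grammar_unique : unique_assignment functional_grammar.
Proof.
move=> o; exists (f o); split; first by rewrite functional_grammar_assigned.
by move=> A; rewrite functional_grammar_assigned => /eqP.
Qed.

Lemma functional_grammar_lang w : w != [::] ->
  cat_lang functional_grammar w <-> reducible [seq f o | o <- w] [:: S].
Proof.
move=> w0; have all2E alpha :
    all2 (@assigned _ functional_grammar) w alpha = (alpha == [seq f o | o <- w]).
  elim: w {w0} alpha => [|o w IHw] [|A alpha] //=.
  by rewrite IHw functional_grammar_assigned eqseq_cons.
split=> [[_ [alpha]]|red]; first by rewrite all2E => /eqP->.
by split=> //; exists [seq f o | o <- w]; rewrite ?all2E.
Qed.

End FunctionalGrammar.

(** * Categorial encoding of infix grammars *)

Section InfixGrammar.
Variables (Op Leaf Q rule : finType) (leafq : Leaf -> Q).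
Variables (op : rule -> Op) (lhs left right : rule -> Q).

Inductive gen : Q -> seq (Op + Leaf) -> Prop :=
  | GenLeaf l : gen (leafq l) [:: inr l]
  | GenRule r u v :
      gen (left r) u -> gen (right r) v -> gen (lhs r) (u ++ inl (op r) :: v).

Definition prim := option (option (option Q)).
Implicit Types (K : category prim) (r : rule) (q : Q).

Definition cA : category prim := Prim None.
Definition cd : category prim := Prim (Some None).
Definition cx : category prim := Prim (Some (Some None)).
Definition hat q : category prim := Prim (Some (Some (Some q))).

(** [cN q] is the category of the nonterminal [q]. *)
Definition cE := Under cx cx.
Definition cD := Over cd cd.
Definition cW := Over (Over cD cA) cE.
Definition cB := Over cW cW.
(** Each of [cE], [cD] and [cDq q] can be absorbed by a neighbouring [cx], [cd] or [hat q], or be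
    taken as an argument; such choices separate the two uses of a gadget. *)
Definition cDq q := Over (hat q) (hat q).
Definition cN q := Under (cDq q) cA.
Definition cK r := Under (cN (left r)) (cN (lhs r)).
Definition cP r := Over (cK r) (cN (right r)).
Definition cR r := Over (cP r) cE.
Definition cJ r := Over (cR r) cW.

(** The gadget of a rule [X -> Y s Z], with positions counted from 0.
    Unused: 1-7 reduce to the dummy [Y], 8-10 to [cP r], 11-13 to the dummy [Z],
    hence 1-13 to [X]; 14-19 reduce to [cJ r]; with these two and the [cD] at 20 as
    arguments, 0 gives [cB].
    Used: 1-7 reduce to [X] and 9-13 to [cD], so 0 gives [cB] again, which is
    absorbed by the [cW] at 14; 16-19 reduce to [cJ r], which turns the [cW]
    ending the block into the argument [cR r] needed at 15.
    The remaining positions (21-22, or 20-22) reduce to one more [cB]. *)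
Definition slot_cats r : seq (category prim) :=
  [:: Over (Over (Over cB cD) (cJ r)) (cN (lhs r));
      cDq (lhs r); hat (lhs r); Under (hat (lhs r)) (Over (cN (lhs r)) cA);
      cDq (left r); hat (left r); Under (hat (left r)) cA;
      Under cA (cN (left r));
      cJ r; cW; cE;
      cDq (right r); hat (right r); Under (hat (right r)) (cN (right r));
      cW; Under cW (Over (cP r) (cR r));
      Over (cR r) cx; cx; cE; Under (cP r) (cJ r); cD; cd; Under cd cB].

Inductive token := Slot of rule & nat | Stop of Op | Fix of Leaf.

Definition tcat t : category prim :=
  match t with
  | Slot r k => nth cA (slot_cats r) k
  | Stop _ => cW
  | Fix l => cN (leafq l)
  end.

Definition rules_of s := [seq r <- enum rule | op r == s].

Definition slots r := [seq Slot r k | k <- iota 0 23].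

Definition block s := flatten [seq slots r | r <- rules_of s] ++ [:: Stop s].

Definition tokens (u : seq (Op + Leaf)) : seq token :=
  flatten [seq match x with inl s => block s | inr l => [:: Fix l] end | x <- u].

Arguments slots : simpl never.
Arguments block : simpl never.

Lemma slots_cats r : [seq tcat t | t <- slots r] = slot_cats r.
Proof. by []. Qed.

Ltac holes n := lazymatch n with
  | O => open_constr:(@nil _)
  | S ?m => let t := holes m in open_constr:(cons _ t)
  end.
Ltac over_at n := let e := holes n in
  refine (@reducible_over _ e _ _ _ _ _); cbn [cat].
Ltac under_at n := let e := holes n in
  refine (@reducible_under _ e _ _ _ _ _); cbn [cat].

Lemma slots_junk r : reducible (slot_cats r) [:: cB; cB].
Proof.
rewrite /slot_cats.
under_at 2. over_at 3. under_at 3. over_at 2. under_at 1. under_at 1.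
over_at 2. over_at 2. over_at 3. under_at 3. over_at 2. under_at 1.
under_at 2. under_at 4. over_at 3. over_at 2. under_at 2.
over_at 0. over_at 0. over_at 0. under_at 1.
exact: reducible_refl.
Qed.

Lemma slots_left r :
  reducible (take 16 (slot_cats r)) [:: cB; cW; Under cW (Over (cP r) (cR r))].
Proof.
cbn [take slot_cats].
over_at 1. under_at 1. under_at 3. under_at 3. under_at 2. over_at 1.
over_at 0. over_at 0. over_at 1. under_at 3. under_at 2. over_at 1. over_at 0.
exact: reducible_refl.
Qed.

Lemma slots_right r : reducible (drop 16 (slot_cats r)) [:: cJ r; cB].
Proof.
cbn [drop slot_cats].
over_at 0. over_at 0. under_at 0. over_at 1. under_at 1.
exact: reducible_refl.
Qed.

Lemma slots_all_junk rs :
  reducible [seq tcat t | t <- flatten [seq slots r | r <- rs]]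
            (nseq (2 * size rs) cB).
Proof.
elim: rs => [|r rs IHrs]; first exact: reducible_refl.
rewrite -[flatten _]/(slots r ++ flatten [seq slots r | r <- rs]) map_cat.
rewrite -[size _]/(size rs).+1 mulnS; exact: (reducible_cat (slots_junk r) IHrs).
Qed.

Lemma block_rule r : reducible [seq tcat t | t <- block (op r)] [:: cP r].
Proof.
have r_in: r \in rules_of (op r) by rewrite mem_filter eqxx mem_enum.
have [rs1 [rs2 rulesE]]: exists rs1 rs2, rules_of (op r) = rs1 ++ r :: rs2.
  by case/splitPr: r_in => rs1 rs2; exists rs1, rs2.
rewrite /block rulesE !map_cat flatten_cat -[flatten (map _ (r :: rs2))]
  /(slots r ++ flatten [seq slots r | r <- rs2]) !map_cat slots_cats.
(* The functor at 15 needs a [cR r], which [cJ r] makes of the closing [cW] once the later gadgets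
   are absorbed; hence the cut after 15. *)
rewrite -(cat_take_drop 16 (slot_cats r)) -!catA.
apply: reducible_trans.
  apply: reducible_cat (slots_all_junk rs1) _.
  apply: reducible_cat (slots_left r) _.
  apply: reducible_cat (slots_right r) _.
  exact: reducible_cat (slots_all_junk rs2) (reducible_refl _).
set n1 := (2 * _)%N; set n2 := (2 * _)%N.
(* One [cB] of the used gadget joins the junk before its [cW] at 14, the other joins the junk before
   the closing [cW], whence [n2.+1]. *)
rewrite (_ : nseq n1 cB ++ _ = (nseq n1 cB ++ [:: cB]) ++ [:: cW] ++
  [:: Under cW (Over (cP r) (cR r)); cJ r] ++ (nseq n2.+1 cB ++ [:: cW])); last first.
  by rewrite /= -!catA.
rewrite (_ : nseq n1 cB ++ [:: cB] = nseq n1.+1 cB); last first.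
  by elim: (n1) => //= n ->.
rewrite catA; apply: reducible_trans.
  apply: (reducible_cat (reducible_absorb _ _)).
  exact: reducible_cat (reducible_refl _) (reducible_absorb _ _).
under_at 0. over_at 1. over_at 0. exact: reducible_refl.
Qed.

Lemma tokens_cat u v : tokens (u ++ v) = tokens u ++ tokens v.
Proof. by rewrite /tokens map_cat flatten_cat. Qed.

Lemma gen_reducible q u : gen q u ->
  reducible [seq tcat t | t <- tokens u] [:: cN q].
Proof.
elim=> {q u} [l|r u v _ IHu _ IHv]; first exact: reducible_refl.
rewrite tokens_cat -[tokens (_ :: _)]/(block (op r) ++ tokens v) map_cat.
rewrite (map_cat _ (block _)); apply: reducible_trans.
  exact: reducible_cat IHu (reducible_cat (block_rule r) IHv).
over_at 1. under_at 0. exact: reducible_refl.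
Qed.

(** * Constituents of encoded words *)

(** Otherwise [cP r] obtained by using the gadget of [r] could take as its left
    argument what 1-13, or the dummy 11-13, of the same gadget reduce to. *)
Hypothesis left_lhs : forall r, left r <> lhs r.
Hypothesis left_right : forall r, left r <> right r.

(** Adjacency of symbols in encoded words, up to the order of the gadgets within a
    block. *)
Inductive succ : token -> token -> Prop :=
  | SuccSlot r k : succ (Slot r k) (Slot r k.+1)
  | SuccNext r r' : op r = op r' -> succ (Slot r 22) (Slot r' 0)
  | SuccStop r : succ (Slot r 22) (Stop (op r))
  | SuccFix s l : succ (Stop s) (Fix l)
  | SuccOpen l r : succ (Fix l) (Slot r 0)
  | SuccEmpty l s : succ (Fix l) (Stop s).

Definition token_op t :=
  match t with Slot r _ => Some (op r) | Stop s => Some s | Fix _ => None end.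

Definition trace t : seq (Op + Leaf) :=
  match t with Slot _ _ => [::] | Stop s => [:: inl s] | Fix l => [:: inr l] end.

(** The symbols with which a constituent [cW] ending at position 14 of the gadget
    of [r] can begin. *)
Definition opens r t : Prop :=
  if t is Slot r' k then
    [/\ op r' = op r, k \in [:: 0; 14; 20; 21] & (k == 14) -> r' = r]
  else False.

(** [item K t1 t2 u]: an overapproximation of the constituents of category [K]
    beginning with [t1] and ending with [t2], where [u] is what they encode; the
    case that matters is [Item_gen]. *)
Inductive item : category prim -> token -> token -> seq (Op + Leaf) -> Prop :=
  | Item_lex r k : k \in [:: 0; 1; 3; 4; 6; 7; 8; 11; 13; 15; 16; 19; 20; 22] ->
      item (nth cA (slot_cats r) k) (Slot r k) (Slot r k) [::]
  | Item_E r k : k \in [:: 10; 18] -> item cE (Slot r k) (Slot r k) [::]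
  | Item_hatX r i : i \in [:: 1; 2] -> item (hat (lhs r)) (Slot r i) (Slot r 2) [::]
  | Item_hatY r i : i \in [:: 4; 5] -> item (hat (left r)) (Slot r i) (Slot r 5) [::]
  | Item_hatZ r i : i \in [:: 11; 12] ->
      item (hat (right r)) (Slot r i) (Slot r 12) [::]
  | Item_C r i : i \in [:: 1; 2] ->
      item (Over (cN (lhs r)) cA) (Slot r i) (Slot r 3) [::]
  | Item_A r i j : i \in [:: 1; 4; 5] -> j \in [:: 6; 7; 13] ->
      item cA (Slot r i) (Slot r j) [::]
  | Item_AZ r : item cA (Slot r 11) (Slot r 13) [::]
  | Item_N r q i j : i \in [:: 1; 2; 4; 5] -> j \in [:: 6; 7; 13] ->
      (j = 13 -> q = lhs r) -> item (cN q) (Slot r i) (Slot r j) [::]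
  | Item_NZ r i : i \in [:: 11; 12] ->
      item (cN (right r)) (Slot r i) (Slot r 13) [::]
  | Item_gen q l l' u : gen q u -> item (cN q) (Fix l) (Fix l') u
  | Item_K r : item (cK r) (Slot r 8) (Slot r 13) [::]
  | Item_Kgen r t l u : opens r t -> gen (right r) u ->
      item (cK r) t (Fix l) (inl (op r) :: u)
  | Item_P8 r : item (cP r) (Slot r 8) (Slot r 10) [::]
  | Item_P16 r : item (cP r) (Slot r 16) (Slot r 18) [::]
  | Item_P r t j : opens r t -> j \in [:: 17; 18] -> item (cP r) t (Slot r j) [::]
  | Item_P14 r r' t : item (cP r) t (Slot r' 14) [::]
  | Item_Pstop r t : opens r t -> item (cP r) t (Stop (op r)) [:: inl (op r)]
  | Item_R8 r : item (cR r) (Slot r 8) (Slot r 9) [::]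
  | Item_R16 r j : j \in [:: 17; 18] -> item (cR r) (Slot r 16) (Slot r j) [::]
  | Item_R14 r r' t : item (cR r) t (Slot r' 14) [::]
  | Item_Rstop r s t : token_op t = Some s -> item (cR r) t (Stop s) [:: inl s]
  | Item_J r t : opens r t \/ t = Slot r 16 -> item (cJ r) t (Slot r 19) [::]
  | Item_PR r t : opens r t -> item (Over (cP r) (cR r)) t (Slot r 15) [::]
  | Item_x r j : j \in [:: 17; 18] -> item cx (Slot r 17) (Slot r j) [::]
  | Item_D r : item cD (Slot r 9) (Slot r 13) [::]
  | Item_DA r : item (Over cD cA) (Slot r 9) (Slot r 10) [::]
  | Item_d r i : i \in [:: 20; 21] -> item cd (Slot r i) (Slot r 21) [::]
  | Item_W r j : j \in [:: 9; 14] -> item cW (Slot r j) (Slot r j) [::]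
  | Item_Wstop s : item cW (Stop s) (Stop s) [:: inl s]
  | Item_W14 r r' k : k \in [:: 0; 20; 21] -> op r = op r' ->
      item cW (Slot r k) (Slot r' 14) [::]
  | Item_Wblock r k : k \in [:: 0; 20; 21] ->
      item cW (Slot r k) (Stop (op r)) [:: inl (op r)]
  | Item_B r j : j \in [:: 13; 20] -> item cB (Slot r 0) (Slot r j) [::]
  | Item_B22 r i : i \in [:: 20; 21] -> item cB (Slot r i) (Slot r 22) [::]
  | Item_BD r j : j \in [:: 8; 19] -> item (Over cB cD) (Slot r 0) (Slot r j) [::]
  | Item_BDJ r j : j \in [:: 6; 7; 13] ->
      item (Over (Over cB cD) (cJ r)) (Slot r 0) (Slot r j) [::].

Lemma item_lex r k : k < 23 -> item (nth cA (slot_cats r) k) (Slot r k) (Slot r k) [::].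
Proof.
do 23?[case: k => [_|k]]; last by [].
all: try by apply: Item_lex.
all: try by apply: Item_E.
all: try by constructor.
all: try by apply: Item_d.
all: try by apply: Item_W.
all: try by apply: Item_x.
all: try by apply: Item_hatX.
all: try by apply: Item_hatY.
all: try by apply: Item_hatZ.
Qed.

Ltac expand := repeat match goal with
 | H : is_true (_ \in [::]) |- _ => by []
 | H : is_true (?k \in (_ :: _)) |- _ =>
     rewrite in_cons in H; case/orP: H => [/eqP H|H]; [try discriminate H; try subst k|]
end.

Ltac split_item H :=
  inversion H; clear H; subst; expand;
  try match goal with H' : nth _ _ _ = _ |- _ => cbn in H' end;
  try discriminate.

Ltac inject := repeat match goal with
  | H : Over _ _ = Over _ _ |- _ => case: H => *; subst
  | H : Under _ _ = Under _ _ |- _ => case: H => *; subst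
  | H : cN _ = cN _ |- _ => case: H => *; subst
  end.

Ltac item_tac := rewrite ?cats0 /=; first
  [ by apply: Item_E | by apply: Item_hatX | by apply: Item_hatY | by apply: Item_hatZ
  | by apply: Item_C | by apply: Item_A | by apply: Item_AZ | by apply: Item_N
  | by apply: Item_NZ | by apply: Item_gen | by apply: Item_K | by apply: Item_Kgen
  | by apply: Item_P8 | by apply: Item_P16 | by apply: Item_P | by apply: Item_P14
  | by apply: Item_Pstop | by apply: Item_R8 | by apply: Item_R16 | by apply: Item_R14
  | by apply: Item_Rstop | by apply: Item_J; auto | by apply: Item_PR | by apply: Item_x
  | by apply: Item_D | by apply: Item_DA | by apply: Item_d | by apply: Item_W
  | by apply: Item_Wstop | by apply: Item_W14 => //; congruence | by apply: Item_B
  | by apply: Item_B22 | by apply: Item_BD | by apply: Item_BDJ ].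

Lemma opens_op r t : opens r t -> token_op t = Some (op r).
Proof. by case: t => //= r' k [-> _ _]. Qed.

(** The list is closed under combining neighbours. A [cR r] or [cP r] ending at 14 is a dead end,
    since no [cE] or [cN q] begins at 15; hence its first symbol can be left arbitrary. *)
Lemma item_over K E t1 t2 t3 t4 u v :
  item (Over K E) t1 t2 u -> succ t2 t3 -> item E t3 t4 v -> item K t1 t4 (u ++ v).
Proof.
move=> H1 H2 H3.
split_item H1; inject; inversion H2; clear H2; subst.
all: split_item H3; inject; try by item_tac.
all: try match goal with H : cDq _ = _ |- _ => case: H => *; subst; by item_tac end.
all: try match goal with H : cJ _ = _ |- _ => case: H => *; subst; by item_tac end.
all: try match goal with H : cD = _ |- _ => case: H => *; subst; by item_tac end.
all: try match goal with |- item cW _ _ _ =>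
       rewrite /=; first
         [ by apply: Item_W14 => //; congruence
         | match goal with H : op _ = op _ |- _ => rewrite -?H end;
           by apply: Item_Wblock
         | by apply: Item_Wblock ] end.
- by apply: Item_Rstop; match goal with H : _ \/ _ |- _ => case: H => [/opens_op|->] end.
- by match goal with H : token_op _ = Some _ |- _ => case: H => <- end; exact: Item_Pstop.
all: match goal with H : opens _ _ \/ _ |- _ =>
       case: H => [[_ isin eqr]|//]; try by [] end.
(* Equal [cJ]s need not come from equal rules, as the category does not record the operation; at
   position 14 [opens] identifies the gadget. *)
by rewrite -(eqr isT); item_tac.
Qed.

Lemma item_under K E t1 t2 t3 t4 u v :
  item E t1 t2 u -> succ t2 t3 -> item (Under E K) t3 t4 v -> item K t1 t4 (u ++ v).
Proof.
move=> H1 H2 H3.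
split_item H3; inject; inversion H2; clear H2; subst.
all: split_item H1; inject; try by item_tac.
all: try match goal with H : cDq _ = _ |- _ => case: H => *; subst; by item_tac end.
all: try match goal with H : opens _ (Slot _ _) |- _ => case: H => [_ + same] => // _ end.
(* Here [cK r] begins at 14 of its own gadget. A dummy ending at 13 there has the nonterminal
   [lhs r] or [right r], hence not [left r]. *)
all: try (exfalso; move: (same isT) => e; subst; by match goal with
     | H : left _ = right _ |- _ => exact: left_right H
     | H : right _ = left _ |- _ => exact: left_right (esym H)
     | H : 13 = 13 -> _ |- _ => exact: left_lhs (H erefl) end).
(* The intended case remains: the [cK r] follows a leaf symbol. *)
by apply: Item_gen; exact: GenRule.
Qed.

(** From position 23 on, [tcat] takes its default value [cA], for which [item] does not provide. *)
Definition slot_bound t := if t is Slot _ k then k < 23 else true.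

Lemma item_token t : slot_bound t -> item (tcat t) t t (trace t).
Proof.
case: t => [r k|s|l] /= k_lt; first exact: item_lex.
  exact: Item_Wstop.
exact/Item_gen/GenLeaf.
Qed.

Fixpoint linked (s : seq token) : Prop :=
  if s is t :: s' then (if s' is t' :: _ then succ t t' else True) /\ linked s'
  else True.

Lemma linked_cat t1 s1 t2 s2 : linked ((t1 :: s1) ++ t2 :: s2) ->
  [/\ linked (t1 :: s1), succ (last t1 s1) t2 & linked (t2 :: s2)].
Proof.
elim: s1 t1 => [|t s1 IHs] t1; first by case.
by case=> t1t /IHs[].
Qed.

Lemma derives_item K s : derives tcat K s -> linked s -> all slot_bound s ->
  if s is t :: s' then item K t (last t s') (flatten [seq trace x | x <- s])
  else False.
Proof.
elim=> {K s} [t _|K E s1 s2 _ IH1 _ IH2|K E s1 s2 _ IH1 _ IH2].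
- by rewrite /= andbT cats0; exact: item_token.
all: case: s1 IH1 => [|t1 s1] IH1; [case: s2 IH2 => // *; exfalso; exact: IH1|].
all: case: s2 IH2 => [|t2 s2] IH2; [move=> *; exfalso; exact: IH2|].
all: move=> /linked_cat[link1 st link2]; rewrite all_cat => /andP[bnd1 bnd2].
all: rewrite map_cat flatten_cat cat_cons last_cat.
- exact: item_over (IH1 link1 bnd1) st (IH2 link2 bnd2).
- exact: item_under (IH1 link1 bnd1) st (IH2 link2 bnd2).
Qed.

(** * Encoded infix words and the finite alphabet *)

Definition infix_word (p : seq (Op * Leaf)) : seq (Op + Leaf) :=
  flatten [seq [:: inl x.1; inr x.2] | x <- p].

Lemma trace_tokens u : flatten [seq trace t | t <- tokens u] = u.
Proof.
elim: u => // -[s|l] u IHu; last by rewrite -[RHS]/([:: inr l] ++ u) -{2}IHu.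
rewrite -[tokens _]/(block s ++ tokens u) map_cat flatten_cat IHu /block.
rewrite map_cat flatten_cat. 
suff ->: flatten [seq trace i | i <- flatten [seq slots r | r <- rules_of s]] = [::].
  by [].
by elim: (rules_of s) => // r rs IHrs; rewrite /= map_cat flatten_cat IHrs.
Qed.

Lemma slot_bound_tokens u : all slot_bound (tokens u).
Proof.
elim: u => // -[s|l] u IHu; last exact: IHu.
rewrite -[tokens _]/(block s ++ tokens u) all_cat IHu /block all_cat andbT /= andbT.
by elim: (rules_of s) => // r rs IHrs; rewrite /= all_cat IHrs.
Qed.

Definition starts s t := t = Stop s \/ exists2 r, op r = s & t = Slot r 0.

Lemma linked_slots r t s : succ (Slot r 22) t -> linked (t :: s) ->
  linked (slots r ++ t :: s).
Proof. by move=> rt link; do 22!(split; first exact: SuccSlot). Qed.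

Lemma linked_block s l v : linked (Fix l :: v) ->
  exists t v', [/\ block s ++ Fix l :: v = t :: v', starts s t & linked (t :: v')].
Proof.
move=> link; rewrite /block -catA /=.
have: all (fun r => op r == s) (rules_of s) by exact: filter_all.
elim: (rules_of s) => [|r rs IHrs] /=.
  by exists (Stop s), (Fix l :: v); split; [|left|split=> //; exact: SuccFix].
move=> /andP[/eqP opr /IHrs[t [v' [-> st link']]]].
exists (Slot r 0), (behead (slots r) ++ t :: v').
split=> //; first by right; exists r.
apply: linked_slots link'; case: st => [->|[r' opr' ->]].
  by rewrite -opr; exact: SuccStop.
by apply: SuccNext; rewrite opr.
Qed.

Lemma linked_tokens p : linked (tokens (infix_word p)) /\
  (forall l, linked (Fix l :: tokens (infix_word p))).
Proof.
elim: p => [|[s l] p [_ IHp]]; first by do 2!split.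
rewrite -[tokens _]/(block s ++ Fix l :: tokens (infix_word p)).
have [t [v [-> st link]]] := linked_block s (IHp l).
split=> // l'; split=> //.
by case: st => [->|[r _ ->]]; [exact: SuccEmpty|exact: SuccOpen].
Qed.

Lemma tokens_last (p0 : Op * Leaf) p t :
  last t (tokens (infix_word (rcons p p0))) = Fix p0.2.
Proof.
rewrite /infix_word -cats1 map_cat flatten_cat tokens_cat last_cat.
exact: last_cat (block p0.1) [:: Fix p0.2].
Qed.

(** The word begins with an operation, so the target is a nonterminal lacking its left part. Among
    the items of such a category, only those of [Item_Kgen] end with a leaf symbol. *)
Theorem reducible_gen a b p : p != [::] ->
  reducible [seq tcat t | t <- tokens (infix_word p)] [:: Under (cN a) (cN b)] ->
  exists r u, [/\ left r = a, lhs r = b, infix_word p = inl (op r) :: u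
                & gen (right r) u].
Proof.
case/lastP: p => // p p0 _ /reducible_derives/derives_item.
have [link _] := linked_tokens (rcons p p0).
move=> /(_ link (slot_bound_tokens _)).
have := @tokens_last p0 p.
case: (tokens _) (trace_tokens (infix_word (rcons p p0))) => // t s -> last_s.
rewrite (last_s t : last t s = _) => it.
by inversion it; subst; exists r, u.
Qed.

Lemma gen_reducible_head r u : gen (right r) u ->
  reducible [seq tcat t | t <- tokens (inl (op r) :: u)] [:: cK r].
Proof.
move=> /gen_reducible red_u.
rewrite -[tokens _]/(block (op r) ++ tokens u) map_cat.
apply: (reducible_trans (reducible_cat (block_rule r) red_u)).
over_at 0; exact: reducible_refl.
Qed.

Definition omega := (rule * 'I_23 + (Op + Leaf))%type.

Definition omega_token (o : omega) : token :=
  match o with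
  | inl rk => Slot rk.1 rk.2
  | inr (inl s) => Stop s
  | inr (inr l) => Fix l
  end.

Definition omega_word (x : Op + Leaf) : seq omega :=
  (if x is inl s then
     flatten [seq [seq inl (r, k) | k <- enum 'I_23] | r <- rules_of s]
   else [::]) ++ [:: inr x].

Lemma omega_wordK u :
  [seq omega_token o | o <- flatten [seq omega_word x | x <- u]] = tokens u.
Proof.
elim: u => // x u IHu; rewrite -[RHS]/(_ ++ tokens u) -IHu map_cat; congr (_ ++ _).
case: x => // s; rewrite /omega_word /block map_cat; congr (_ ++ _).
rewrite map_flatten -map_comp; congr flatten; apply: eq_map => r /=.
by rewrite -map_comp /slots -val_enum_ord -map_comp.
Qed.

Theorem infix_grammar_encoding (a b : Q) :
  exists (Omega : finType) (g : Op + Leaf -> seq Omega) (G : cat_grammar Omega),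
    [/\ forall x, g x != [::], unique_assignment G
      & forall p, p != [::] ->
          (cat_lang G (flatten [seq g x | x <- infix_word p]) <->
           exists r u, [/\ left r = a, lhs r = b, infix_word p = inl (op r) :: u
                         & gen (right r) u])].
Proof.
exists omega, omega_word.
exists (functional_grammar (fun o => tcat (omega_token o)) (Under (cN a) (cN b))).
split=> [x||p p0]; [|exact: functional_grammar_unique|].
  by rewrite /omega_word; case: (if _ is inl _ then _ else _).
apply: iff_trans (functional_grammar_lang _ _ _) _.
  by case: p p0 => // x p _; rewrite /= /omega_word; case: flatten.
rewrite (map_comp tcat) omega_wordK; split=> [|[r [u [<- <- -> /gen_reducible_head]]] //].
exact: reducible_gen.
Qed.

End InfixGrammar.

(** * Derivations in context-free grammars *)

Section Yields.
Variables (Sigma : finType) (G : cfg Sigma).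
Let symbol := (nonterminal G + Sigma)%type.
Implicit Types (eta theta s : seq symbol) (u v w : seq Sigma).

Inductive yields : seq symbol -> seq Sigma -> Prop :=
  | YieldsNil : yields [::] [::]
  | YieldsTerminal a s w : yields s w -> yields (inr a :: s) (a :: w)
  | YieldsRule X rhs s u v of (X, rhs) \in rules G :
      yields rhs u -> yields s v -> yields (inl X :: s) (u ++ v).

Lemma yields_cat s1 s2 u v : yields s1 u -> yields s2 v -> yields (s1 ++ s2) (u ++ v).
Proof.
move=> y1 y2; elim: y1 => {s1 u} //= [a s w _ IH|X rhs s u1 u2 Xr yr _ _ IH].
  exact: YieldsTerminal.
by rewrite -catA; exact: YieldsRule Xr yr IH.
Qed.

Lemma yields_catI s1 s2 w : yields (s1 ++ s2) w ->
  exists u v, [/\ w = u ++ v, yields s1 u & yields s2 v].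
Proof.
elim: s1 w => [|x s1 IH] w /= y; first by exists [::], w; split=> //; exact: YieldsNil.
move E: (x :: _) y => s y; case: y E => // [a s' v y|X rhs s' u v Xr y1 y2] [-> sE].
  have [u [v' [-> y1 y2]]] := IH v ltac:(by rewrite sE).
  by exists (a :: u), v'; split=> //; exact: YieldsTerminal.
have [u' [v' [-> y1' y2']]] := IH v ltac:(by rewrite sE).
by exists (u ++ u'), v'; rewrite catA; split=> //; exact: YieldsRule Xr y1 y1'.
Qed.

Lemma yields_terminals w : yields [seq inr a | a <- w] w.
Proof. by elim: w => [|a w IHw]; [exact: YieldsNil|exact: YieldsTerminal]. Qed.

Lemma cfg_steps_ctx eta theta s1 s2 :
  clos_refl_trans _ (@cfg_step _ G) s1 s2 ->
  clos_refl_trans _ (@cfg_step _ G) (eta ++ s1 ++ theta) (eta ++ s2 ++ theta).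
Proof.
elim=> {s1 s2} [_ _ [eta' theta' X rhs Xr]|s|s1 s2 s3 _ IH1 _ IH2].
- rewrite -!catA (catA eta eta') (catA eta eta'); apply: rt_step.
  exact: (CfgStep (eta ++ eta') (theta' ++ theta)).
- exact: rt_refl.
- exact: rt_trans IH1 IH2.
Qed.

Lemma yieldsP s w :
  clos_refl_trans _ (@cfg_step _ G) s [seq inr a | a <- w] <-> yields s w.
Proof.
split=> [steps|].
  move: (yields_terminals w); elim: steps => {s} [_ _ [eta theta X rhs Xr]|//|].
    move=> /yields_catI[u [_ [-> y1 /yields_catI[v1 [v2 [-> y2 y3]]]]]].
    by apply: yields_cat y1 _; exact: YieldsRule Xr y2 y3.
  by move=> s1 s2 s3 _ IH1 _ IH2 /IH2/IH1.
elim=> {s w} [|a s w _ IH|X rhs s u v Xr _ IH1 _ IH2].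
- exact: rt_refl.
- by have := @cfg_steps_ctx [:: inr a] [::] _ _ IH; rewrite !cats0.
- apply: (rt_trans _ _ _ (rhs ++ s)); first exact/rt_step/(CfgStep [::] s).
  apply: (rt_trans _ _ _ ([seq inr a | a <- u] ++ s)).
    exact: (@cfg_steps_ctx [::]).
  rewrite map_cat.
  by have := @cfg_steps_ctx [seq inr a | a <- u] [::] _ _ IH2; rewrite !cats0.
Qed.

(** A finite set of forms containing all right-hand sides and closed under passing to the first
    symbol or to the rest; this is what [yields_split] needs. *)
Definition sentential : seq (seq symbol) :=
  [::] :: [seq [:: x] | x <- enum {: nonterminal G + Sigma}] ++
  flatten [seq [seq drop i r.2 | i <- iota 0 (size r.2).+1] | r <- rules G].

Lemma sentential1 x : [:: x] \in sentential.
Proof. by rewrite inE mem_cat map_f ?mem_enum. Qed.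

Lemma sentential_rhs X rhs : (X, rhs) \in rules G -> rhs \in sentential.
Proof.
move=> Xr; rewrite inE mem_cat; apply/orP; right; apply/orP; right.
by apply/flatten_mapP; exists (X, rhs); rewrite //= drop0 inE eqxx.
Qed.

Lemma sentential_behead x s : x :: s \in sentential -> s \in sentential.
Proof.
rewrite in_cons mem_cat => /or3P[//|/mapP[y _ [_ ->]]|]; first by rewrite inE.
move=> /flatten_mapP[r rG] /mapP[i]; rewrite mem_iota => /andP[_ i_lt] sE.
rewrite inE mem_cat; apply/orP; right; apply/orP; right.
apply/flatten_mapP; exists r => //; apply/mapP; exists i.+1.
  rewrite mem_iota /= ltnS ltn_neqAle -ltnS i_lt andbT.
  by apply/eqP => iE; move: sE; rewrite iE drop_size.
by rewrite -add1n -drop_drop -sE /= drop0.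
Qed.

(** Descend in the derivation: if the first symbol yields the empty word, pass to the rest of the
    form; if the rest does, pass to the right-hand side; otherwise cut after the first symbol. The
    last clause is the condition of [ValidConcat]. *)
Lemma yields_split s w : yields s w -> s \in sentential -> 1 < size w ->
  exists s1 s2 u v,
    [/\ s1 \in sentential /\ s2 \in sentential, w = u ++ v,
        u != [::] /\ v != [::], yields s1 u /\ yields s2 v
      & forall u' v', yields s1 u' -> yields s2 v' -> yields s (u' ++ v')].
Proof.
elim=> {s w} [//|a s w y _ ss w1|X rhs s u v Xr y1 IH1 y2 IH2 ss uv1].
  exists [:: inr a], s, [:: a], w; split=> //.
  - by split; [exact: sentential1|exact: sentential_behead ss].
  - by split=> //; case: w w1 {y}.
  - by split=> //; exact: (yields_terminals [:: a]).
  - by move=> u' v'; exact: yields_cat.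
case: u => [|a u] in y1 IH1 uv1 *.
  have [s1 [s2 [u' [v' [? ? ? ? y]]]]] := IH2 (sentential_behead ss) uv1.
  exists s1, s2, u', v'; split=> // u2 v2 /y{}y /y{}y.
  exact: (YieldsRule Xr y1 y).
case: v => [|b v] in y2 IH2 uv1 *.
  rewrite cats0 in uv1 *.
  have [s1 [s2 [u' [v' [? ? ? ? y]]]]] := IH1 (sentential_rhs Xr) uv1.
  exists s1, s2, u', v'; split=> // u2 v2 /y{}y /y{}y.
  by rewrite -[u2 ++ v2]cats0; exact: (YieldsRule Xr y y2).
exists [:: inl X], s, (a :: u), (b :: v); split=> //.
- by split; [exact: sentential1|exact: sentential_behead ss].
- split=> //; rewrite -[a :: u]cats0; exact: YieldsRule Xr y1 YieldsNil.
- by move=> u' v'; exact: yields_cat.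
Qed.

End Yields.

(** * From context-free to infix grammars *)

Section InfixOfCfg.
Variables (Sigma : finType) (G : cfg Sigma).

Definition phrase := seq_sub (sentential G).
Definition node := (phrase * option bool + bool * bool)%type.
Implicit Types (s : phrase) (t : option bool) (u v w : seq Sigma).

Definition leaf_node b : node := inr (true, b).
(** The missing left part of the target is represented by [goal_node false], which generates
    nothing. *)
Definition goal_node b : node := inr (false, b).
Definition start_phrase : phrase := SeqSub (sentential1 (inl (start G))).
(** The value differs from [t] and from [None], the tag of a right child. *)
Definition left_tag t := Some (t != Some true).

(** [None] is the concatenation symbol.  Taking all sound concatenations as rules,
    rather than those read off from [G], makes the elimination of empty and unit
    productions unnecessary.  The tags serve to make the left child of a node
    different from the node itself and from the right child. *)
Inductive valid : option Sigma -> node -> node -> node -> Prop :=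
  | ValidConcat s s1 s2 t of
      (forall u v, yields (val s1) u -> yields (val s2) v -> yields (val s) (u ++ v)) :
      valid None (inl (s, t)) (inl (s1, left_tag t)) (inl (s2, None))
  | ValidLetter a s t of yields (val s) [:: a] :
      valid (Some a) (inl (s, t)) (leaf_node true) (leaf_node false)
  | ValidGoal :
      valid None (goal_node true) (goal_node false) (inl (start_phrase, None)).

(** [ValidConcat] quantifies over all words, so the finite type of rules is carved out
    classically. *)
Definition infix_rule :=
  {x : option Sigma * (node * node * node) | `[< valid x.1 x.2.1.1 x.2.1.2 x.2.2 >]}.
Implicit Types (r : infix_rule).

Definition rule_op r := (val r).1.
Definition rule_lhs r := (val r).2.1.1.
Definition rule_left r := (val r).2.1.2.
Definition rule_right r := (val r).2.2.

Lemma rule_valid r : valid (rule_op r) (rule_lhs r) (rule_left r) (rule_right r).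
Proof. exact/asboolP/(valP r). Qed.

Lemma valid_rule o q q1 q2 : valid o q q1 q2 ->
  exists r, [/\ rule_op r = o, rule_lhs r = q, rule_left r = q1 & rule_right r = q2].
Proof. by move=> /asboolP vr; exists (exist _ (o, (q, q1, q2)) vr). Qed.

Lemma rule_left_lhs r : rule_left r <> rule_lhs r.
Proof. by case: (rule_valid r) => // s s1 s2 [[]|] _ []. Qed.

Lemma rule_left_right r : rule_left r <> rule_right r.
Proof. by case: (rule_valid r). Qed.

Let generates := gen leaf_node rule_op rule_lhs rule_left rule_right.

Lemma generates_valid o q q1 q2 x y : valid o q q1 q2 ->
  generates q1 x -> generates q2 y -> generates q (x ++ inl o :: y).
Proof. by move=> /valid_rule[r [<- <- <- <-]]; exact: GenRule. Qed.

Definition letters (x : seq (option Sigma + bool)) : seq Sigma :=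
  pmap (fun c => if c is inl (Some a) then Some a else None) x.

Lemma generates_yields q x : generates q x ->
  match q with
  | inl (s, _) => yields (val s) (letters x)
  | inr (true, _) => letters x = [::]
  | inr (false, _) => True
  end.
Proof.
elim=> {q x} // r x y _ + _ +; rewrite /letters pmap_cat /=.
case: (rule_valid r) => // [s s1 s2 t cat yx yy|a s t ya /= -> ->] //; exact: cat.
Qed.

Definition code w : seq (option Sigma * bool) :=
  flatten [seq [:: (None, true); (Some a, false)] | a <- w].

Lemma letters_code w : letters (infix_word (code w)) = w.
Proof. by elim: w => //= a w IHw; congr (_ :: _). Qed.

Lemma code_cat u v :
  infix_word (code (u ++ v)) = infix_word (code u) ++ infix_word (code v).
Proof. by rewrite /infix_word /code map_cat flatten_cat map_cat flatten_cat. Qed.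

(** Without its leading concatenation symbol the code begins and ends with leaf symbols, as
    generated words do. *)
Definition body w := behead (infix_word (code w)).

Lemma infix_body w : w != [::] -> infix_word (code w) = inl None :: body w.
Proof. by case: w. Qed.

Lemma body_cat u v : u != [::] -> v != [::] ->
  body (u ++ v) = body u ++ inl None :: body v.
Proof. by move=> u0 v0; rewrite -infix_body // /body code_cat (infix_body u0). Qed.

(** Induction on the length of [w], cutting longer words by [yields_split]. The tag is arbitrary
    because that of a left child depends on its parent. *)
Lemma yields_generates s t w : w != [::] -> yields (val s) w ->
  generates (inl (s, t)) (body w).
Proof.
have [n] := ubnP (size w); elim: n w s t => // n IHn w s t w_lt w0 yw.
case: w => [//|a [|b w]] in w_lt w0 yw *.
  exact: (generates_valid (ValidLetter t yw) (GenLeaf _ _ _ _ _ true)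
    (GenLeaf _ _ _ _ _ false)).
have [s1 [s2 [u [v [[s1P s2P] wE [u0 v0] [y1 y2] cat]]]]] :=
  yields_split yw (valP s) isT.
have [u_lt v_lt]: size u < n /\ size v < n.
  have: size u + size v <= n by rewrite -size_cat -wE.
  case: u u0 {y1 wE} => // c u _; case: v v0 {y2} => // d v _ /=.
  rewrite addSn addnS => uv.
  by split; apply: leq_trans uv; rewrite !ltnS ?leq_addr ?leq_addl.
rewrite wE body_cat //.
apply: (@generates_valid None _ (inl (SeqSub s1P, left_tag t)) (inl (SeqSub s2P, None))).
- exact: ValidConcat.
- exact: IHn.
- exact: IHn.
Qed.

End InfixOfCfg.

Theorem theorem1 (Sigma : finType) (L : language Sigma)
    (L_nonempty : forall w : seq Sigma, L w -> w != [::])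
    (L_cf : context_free L) :
  exists (Omega : finType) (h : Sigma -> seq Omega) (G : cat_grammar Omega),
    [/\ forall a : Sigma, h a != [::],
        unique_assignment G
      & forall w : seq Sigma, w != [::] ->
          (L w <-> cat_lang G (hom_ext h w))].
Proof.
case: L_cf => C LC.
have [Omega [g [G [g0 G_unique G_lang]]]] := infix_grammar_encoding
  (@leaf_node _ C) (@rule_op _ C) (@rule_left_lhs _ C) (@rule_left_right _ C)
  (goal_node _ false) (goal_node _ true).
exists Omega, (fun a => flatten [seq g x | x <- infix_word (code [:: a])]), G.
split=> // [a|w w0].
  by rewrite /=; case: (g _) (g0 (inl None)).
have ->: hom_ext (fun a => flatten [seq g x | x <- infix_word (code [:: a])]) w =
    flatten [seq g x | x <- infix_word (code w)].
  by elim: w {w0} => // a w IHw; rewrite -cat1s code_cat map_cat flatten_cat -IHw.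
have code0 : code w != [::] by case: w w0.
apply: iff_trans (LC w) (iff_trans _ (iff_sym (G_lang _ code0))).
split=> [/(yieldsP [:: inl _])yw|[r [x [leftE lhsE wE xgen]]]].
  have [r [opE lhsE leftE rightE]] := valid_rule (ValidGoal C).
  exists r, (body w); rewrite opE rightE (infix_body w0); split=> //.
  exact: yields_generates.
apply/(yieldsP [:: inl _]); rewrite -(letters_code w) wE.
(* Only [ValidGoal] has [goal_node false] as its left child. *)
move: leftE lhsE xgen; by case: (rule_valid r) => // _ _ /generates_yields.
Qed.
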